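(* Let $q$ be a prime power. Let $a, u, v \in \mathbb{F}_{q^2}$ with $a^{q+1}=1$ and $au-v\neq 0$, and let $g(x)=b_1x+b_2x^2+\cdots+b_{q-1}x^{q-1}$ with $b_1,\dots,b_{q-1}\in\mathbb{F}_{q^2}$. Consider the following two conditions: (i) there is some $c\in\mathbb{F}_q^*$ such that $au+v^q+b_1^qa^{-1}+b_1a=c$ and $u^q+av+a(b_1^qa^{-1}+b_1a)=ac$, and $b_i^qa^{-i}+b_ia=0$ for $i=2,3,\dots,q-1$; (ii) there is some $c\in\mathbb{F}_q^*$ such that $u+av^q+b_1^q+b_1=c$ and $au^q+v+a(b_1^q+b_1)=ac$, and $b_i^qa^{-i+1}+b_i=0$ for $i=2,3,\dots,q-1$. If (i) or (ii) holds, then the polynomial $$f(x)=ux^q+vx+g(x^q+ax)$$ is a permutation polynomial over $\mathbb{F}_{q^2}$. Moreover, if (i) holds with $c\in\mathbb{F}_q^*$, then the compositional inverse of $f(x)$ over $\mathbb{F}_{q^2}$ is given by $$f^{-1}(x)=(v-au)^{-1}\left(x-g\left(c^{-1}x^q+c^{-1}ax\right)-uc^{-1}(x^q+ax)\right);$$ and if (ii) holds with $c\in\mathbb{F}_q^*$, then the compositional inverse of $f(x)$ over $\mathbb{F}_{q^2}$ is given by $$f^{-1}(x)=(v-au)^{-1}\left(x-g\left(c^{-1}ax^q+c^{-1}x\right)-uc^{-1}(ax^q+x)\right).$$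
   Context: For a prime power $Q$, $\mathbb{F}_Q$ is the finite field with $Q$ elements and $\mathbb{F}_Q^*=\mathbb{F}_Q\setminus\{0\}$; $\mathbb{F}_q$ is regarded as a subfield of $\mathbb{F}_{q^2}$. A polynomial $f\in\mathbb{F}_Q[x]$ is a permutation polynomial over $\mathbb{F}_Q$ if the map $c\mapsto f(c)$ from $\mathbb{F}_Q$ to itself is bijective. Its compositional inverse $f^{-1}(x)$ is the polynomial (unique modulo $x^Q-x$) with $f(f^{-1}(x))\equiv f^{-1}(f(x))\equiv x \pmod{x^Q-x}$; equalities between $f^{-1}$ and an explicit polynomial are understood modulo $x^Q-x$, i.e. as equalities of maps on $\mathbb{F}_Q$. *)

(* Defs.v *)
From mathcomp Require Import all_boot all_order all_algebra.

Set Implicit Arguments.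
Unset Strict Implicit.
Unset Printing Implicit Defensive.

Import GRing.Theory.
Local Open Scope ring_scope.

Definition prime_power (q : nat) : Prop :=
  exists p k : nat, [/\ prime p, (0 < k)%N & q = (p ^ k)%N].

Definition permutation_poly (F : finFieldType) (f : {poly F}) : Prop :=
  bijective (fun c : F => f.[c]).

(* f(h(x)) = h(f(x)) = x modulo x^Q - x, where Q = #|F|.  This determines h
   only up to multiples of x^Q - x, as usual for compositional inverses. *)
Definition comp_inverse (F : finFieldType) (f h : {poly F}) : Prop :=
  ('X^#|F| - 'X %| f \Po h - 'X) /\ ('X^#|F| - 'X %| h \Po f - 'X).

(* Only the values b 1, ..., b (q - 1) of b matter. *)
Definition gpoly (F : fieldType) (q : nat) (b : nat -> F) : {poly F} :=
  \sum_(1 <= i < q) b i *: 'X^i.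

Definition fpoly (F : fieldType) (q : nat) (a u v : F) (b : nat -> F) :
    {poly F} :=
  u *: 'X^q + v *: 'X + (gpoly q b \Po ('X^q + a *: 'X)).

(* Exponents of a are integers: x ^ n with n : int. *)
Definition cond_i (F : fieldType) (q : nat) (a u v : F) (b : nat -> F)
    (c : F) : Prop :=
  [/\ a * u + v ^+ q + b 1%N ^+ q * a^-1 + b 1%N * a = c,
      u ^+ q + a * v + a * (b 1%N ^+ q * a^-1 + b 1%N * a) = a * c
    & forall i : nat, (2 <= i <= q - 1)%N ->
        b i ^+ q * a ^ (- i%:Z) + b i * a = 0].

Definition cond_ii (F : fieldType) (q : nat) (a u v : F) (b : nat -> F)
    (c : F) : Prop :=
  [/\ u + a * v ^+ q + b 1%N ^+ q + b 1%N = c,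
      a * u ^+ q + v + a * (b 1%N ^+ q + b 1%N) = a * c
    & forall i : nat, (2 <= i <= q - 1)%N ->
        b i ^+ q * a ^ (- i%:Z + 1) + b i = 0].

(* Main.v *)
(* Let y = x^q + a x.  Since a^(q+1) = 1 and x^(q^2) = x, we have y^q = y / a, so
   on such y the map z |-> z^q acts on g(y) by twisting its coefficients, and both
   conditions say that some form d z^q + e z maps z = f(x) to c y: the form is
   z^q + a z under (i) and a z^q + z under (ii).  Hence y is determined by z, and
   f(x) = u y + (v - a u) x + g(y) can be solved for x. *)
Require Import Defs.
From mathcomp Require Import all_boot all_order all_algebra all_field ring.

Set Implicit Arguments.
Unset Strict Implicit.
Unset Printing Implicit Defensive.

Import GRing.Theory.
Local Open Scope ring_scope.

(** The divisor is the product of ['X - x] over all x in [F], and [p] vanishes at each of these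
    distinct points. *)
Lemma dvdp_genPolyP (F : finFieldType) (p : {poly F}) :
  (forall x : F, p.[x] = 0) -> 'X^#|F| - 'X %| p.
Proof.
move=> p0; rewrite finField_genPoly -big_enum.
apply: uniq_roots_dvdp; first by apply/allP => x _; apply/rootP.
by rewrite uniq_rootsE enum_uniq.
Qed.

Lemma horner_cancel_comp_inverse (F : finFieldType) (f h : {poly F}) :
  cancel (horner f) (horner h) -> comp_inverse f h.
Proof.
(* On a finite set a left inverse is two-sided. *)
move=> fK; have hK : cancel (horner h) (horner f) by apply: canF_sym.
by split; apply: dvdp_genPolyP => x;
  rewrite hornerD hornerN hornerX horner_comp ?hK ?fK subrr.
Qed.

Lemma horner_cancel_permutation (F : finFieldType) (f h : {poly F}) :
  cancel (horner f) (horner h) -> permutation_poly f.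
Proof. by move=> fK; apply: injF_bij; apply: can_inj fK. Qed.

(** Makes z |-> z^q additive on [F]: [q] is a power of the characteristic. *)
Lemma pchar_nat_card (F : finFieldType) (q n : nat) :
  prime_power q -> #|F| = (q ^ n)%N -> [pchar F].-nat q.
Proof.
move=> [p [k [p_pr _ ->]]]; rewrite -expnM => cardF.
by rewrite pnatX pnatE // (card_finPcharP cardF p_pr).
Qed.

Lemma horner_gpoly (F : fieldType) (q : nat) (b : nat -> F) (y : F) :
  (gpoly q b).[y] = \sum_(1 <= i < q) b i * y ^+ i.
Proof.
by rewrite horner_sum; apply: eq_bigr => i _; rewrite hornerZ hornerXn.
Qed.

Lemma horner_fpoly (F : fieldType) (q : nat) (a u v : F) (b : nat -> F) (x : F) :
  (fpoly q a u v b).[x] = u * x ^+ q + v * x + (gpoly q b).[x ^+ q + a * x].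
Proof. by rewrite /fpoly !hornerD horner_comp !hornerE. Qed.

Section TwistedForm.

Variables (q : nat) (F : finFieldType) (a : F).
Hypotheses (hq : prime_power q) (cardF : #|F| = (q ^ 2)%N) (ha : a ^+ q.+1 = 1).

Let q_gt1 : (1 < q)%N.
Proof. by case: hq => p [k [p_pr k0 ->]]; rewrite -(exp1n k) ltn_exp2r ?prime_gt1. Qed.

Let addX (x y : F) : (x + y) ^+ q = x ^+ q + y ^+ q.
Proof. exact: exprDn_pchar (pchar_nat_card hq cardF). Qed.

Let exprqq (x : F) : (x ^+ q) ^+ q = x.
Proof. by rewrite -exprM mulnn -cardF expf_card. Qed.

Let a_unit : a != 0.
Proof. by apply/eqP => a0; move: ha; rewrite a0 expr0n => /eqP; rewrite eq_sym oner_eq0. Qed.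

Let aX : a ^+ q = a^-1.
Proof. by apply: (mulfI a_unit); rewrite -exprS ha divff. Qed.

(** The q-th power sends x^q to x and a x to a^-1 x^q, which are a^-1 times the two terms in swapped
    order. *)
Lemma trace_formX (x : F) : (x ^+ q + a * x) ^+ q = a^-1 * (x ^+ q + a * x).
Proof. by rewrite addX exprMn exprqq aX mulrDr mulKf // addrC. Qed.

(** Since (b_i y^i)^q = b_i^q a^-i y^i, the coefficient of y^i on the left is d b_i^q a^-i + e b_i;
    the last hypothesis leaves only i = 1. *)
Lemma gpoly_twist (b : nat -> F) (d e y : F) :
    y ^+ q = a^-1 * y ->
    (forall i, (2 <= i <= q - 1)%N -> d * (b i ^+ q * a ^- i) + e * b i = 0) ->
  d * (gpoly q b).[y] ^+ q + e * (gpoly q b).[y]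
    = (d * (b 1%N ^+ q * a^-1) + e * b 1%N) * y.
Proof.
move=> yX b0; rewrite horner_gpoly.
have sumX (r : seq nat) (G : nat -> F) :
    (\sum_(i <- r) G i) ^+ q = \sum_(i <- r) G i ^+ q.
  by apply: (big_morph (fun z : F => z ^+ q) addX); rewrite expr0n gtn_eqF // ltnW.
(* The term i = 1 exists because 1 < q. *)
rewrite sumX !mulr_sumr -big_split /= big_ltn // big_nat big1 => [|i /andP[i2 iq]].
  by rewrite addr0 !expr1 exprMn yX; ring.
have -> : (b i * y ^+ i) ^+ q = b i ^+ q * a ^- i * y ^+ i.
  by rewrite exprMn exprAC yX exprMn exprVn mulrA.
rewrite !mulrA -mulrDl -mulrA b0 ?mul0r //.
by rewrite i2 -ltnS subn1 prednK // ltnW.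
Qed.

(** As (u x^q)^q = u^q x, the q-th power exchanges x^q and x in the linear part of f. The first two
    hypotheses give the coefficients of x^q and x once the contribution of g, a multiple t y of y =
    x^q + a x, is split between them. *)
Lemma fpoly_twist (u v c d e : F) (b : nat -> F) (x : F) :
    d * v ^+ q + e * u + (d * (b 1%N ^+ q * a^-1) + e * b 1%N) = c ->
    d * u ^+ q + e * v + a * (d * (b 1%N ^+ q * a^-1) + e * b 1%N) = a * c ->
    (forall i, (2 <= i <= q - 1)%N -> d * (b i ^+ q * a ^- i) + e * b i = 0) ->
  d * (fpoly q a u v b).[x] ^+ q + e * (fpoly q a u v b).[x]
    = c * (x ^+ q + a * x).
Proof.
move=> c1 c2 /(gpoly_twist (trace_formX x)) gT.
rewrite horner_fpoly !addX !exprMn exprqq.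
set t := _ + e * b 1%N in c1 c2 gT.
move: gT; set y := x ^+ q + a * x; set w := (gpoly q b).[y] => gT.
transitivity ((d * v ^+ q + e * u) * x ^+ q + (d * u ^+ q + e * v) * x
              + (d * w ^+ q + e * w)); first by ring.
rewrite gT /y.
transitivity ((d * v ^+ q + e * u + t) * x ^+ q
              + (d * u ^+ q + e * v + a * t) * x); first by ring.
by rewrite c1 c2; ring.
Qed.

(** For z = f(x), the argument of g in the candidate inverse is c^-1 (d z^q + e z) = y, where y =
    x^q + a x. Then z - g(y) - u y = (v - a u) x, since u x^q cancels. *)
Lemma fpoly_twistK (u v c d e : F) (b : nat -> F) :
    a * u - v != 0 -> c != 0 ->
    d * v ^+ q + e * u + (d * (b 1%N ^+ q * a^-1) + e * b 1%N) = c ->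
    d * u ^+ q + e * v + a * (d * (b 1%N ^+ q * a^-1) + e * b 1%N) = a * c ->
    (forall i, (2 <= i <= q - 1)%N -> d * (b i ^+ q * a ^- i) + e * b i = 0) ->
  cancel (horner (fpoly q a u v b))
    (horner ((v - a * u)^-1 *:
       ('X - (gpoly q b \Po ((c^-1 * d) *: 'X^q + (c^-1 * e) *: 'X))
           - (u * c^-1) *: (d *: 'X^q + e *: 'X)))).
Proof.
move=> auv c0 c1 c2 cb x; have T := fpoly_twist x c1 c2 cb.
rewrite !(hornerE, horner_comp) -horner_fpoly -!(mulrA c^-1) -mulrDr.
rewrite -(mulrA u) T mulKf // horner_fpoly.
have vau : v - a * u != 0 by rewrite -opprB oppr_eq0.
by apply: (mulfI vau); rewrite mulVKf //; ring.
Qed.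

Lemma cond_iK (u v c : F) (b : nat -> F) :
    a * u - v != 0 -> c != 0 -> cond_i q a u v b c ->
  cancel (horner (fpoly q a u v b))
    (horner ((v - a * u)^-1 *:
       ('X - (gpoly q b \Po (c^-1 *: 'X^q + (c^-1 * a) *: 'X))
           - (u * c^-1) *: ('X^q + a *: 'X)))).
Proof.
move=> auv c0 [c1 c2 cb].
(* Condition (i) is the case d = 1, e = a. *)
have := @fpoly_twistK u v c 1 a b auv c0; rewrite mulr1 scale1r; apply.
- by rewrite -c1; ring.
- by rewrite -c2; ring.
- by move=> i /cb <-; rewrite mul1r -exprnN [a * _]mulrC.
Qed.

Lemma cond_iiK (u v c : F) (b : nat -> F) :
    a * u - v != 0 -> c != 0 -> cond_ii q a u v b c ->
  cancel (horner (fpoly q a u v b))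
    (horner ((v - a * u)^-1 *:
       ('X - (gpoly q b \Po ((c^-1 * a) *: 'X^q + c^-1 *: 'X))
           - (u * c^-1) *: (a *: 'X^q + 'X)))).
Proof.
move=> auv c0 [c1 c2 cb].
(* Condition (ii) is the case d = a, e = 1; here d cancels the a^-1 attached to b_1^q. *)
have := @fpoly_twistK u v c a 1 b auv c0; rewrite mulr1 scale1r.
rewrite !mul1r [a * (_ * _)]mulrC divfK //; apply.
- by rewrite -c1; ring.
- by rewrite -c2; ring.
(* The integer power splits as a^(-i + 1) = a^-i a because a is nonzero. *)
- by move=> i /cb <-; rewrite mul1r expfzDr // expr1z -exprnN; ring.
Qed.

End TwistedForm.

(* K = F_q is regarded as a subfield of F = F_{q^2} through iota. *)
Theorem theorem3p1 (q : nat) (hq : prime_power q)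
    (K F : finFieldType) (iota : {rmorphism K -> F})
    (cardK : #|K| = q) (cardF : #|F| = (q ^ 2)%N)
    (a u v : F) (ha : a ^+ q.+1 = 1) (hauv : a * u - v != 0)
    (b : nat -> F) :
  let g : {poly F} := gpoly q b in
  let f : {poly F} := fpoly q a u v b in
  [/\ (exists c : K, c != 0 /\ cond_i q a u v b (iota c)) \/
      (exists c : K, c != 0 /\ cond_ii q a u v b (iota c)) ->
        permutation_poly f,
      forall c : K, c != 0 -> cond_i q a u v b (iota c) ->
        comp_inverse f
          ((v - a * u)^-1 *:
             ('X - (g \Po ((iota c)^-1 *: 'X^q + ((iota c)^-1 * a) *: 'X))
                - (u * (iota c)^-1) *: ('X^q + a *: 'X)))
    & forall c : K, c != 0 -> cond_ii q a u v b (iota c) ->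
        comp_inverse f
          ((v - a * u)^-1 *:
             ('X - (g \Po (((iota c)^-1 * a) *: 'X^q + (iota c)^-1 *: 'X))
                - (u * (iota c)^-1) *: (a *: 'X^q + 'X)))].
Proof.
move=> g f.
have iota0 c : c != 0 -> iota c != 0 by rewrite fmorph_eq0.
split=> [[] [c [/iota0 c0 hc]] | c /iota0 c0 hc | c /iota0 c0 hc].
(* The explicit left inverse gives injectivity, hence bijectivity on a finite set. *)
- exact: horner_cancel_permutation (cond_iK hq cardF ha hauv c0 hc).
- exact: horner_cancel_permutation (cond_iiK hq cardF ha hauv c0 hc).
- exact/horner_cancel_comp_inverse/(cond_iK hq cardF ha hauv c0 hc).
- exact/horner_cancel_comp_inverse/(cond_iiK hq cardF ha hauv c0 hc).
Qed.
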